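(* Let $K$ be a field, $S=K[x_1,\ldots,x_n]$, and let $d\geq 1$ be an integer. Let $I$ be the ideal of $S$ generated by a single square free monomial $f$ of degree $d$, and let $J\subsetneq I$ be a square free monomial ideal generated in degrees $\geq d+1$. Suppose that $\rho_{d+1}(I\setminus J)>\rho_{d+2}(I\setminus J)+1$. Then $\operatorname{depth}_S I/J=d+1$.
   Context: A square free monomial ideal is an ideal generated by square free monomials; the zero ideal is allowed for $J$. ''Generated in degrees $\geq d+1$'' means that it is generated by (square free) monomials each of degree at least $d+1$. For an integer $j$, $\rho_j(I\setminus J)$ denotes the number of all square free monomials of degree $j$ of $S$ that belong to $I$ but not to $J$ (so it is $0$ for $j>n$). $\operatorname{depth}_S I/J$ is the depth of the graded $S$-module $I/J$ with respect to the graded maximal ideal $(x_1,\ldots,x_n)$. *)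

(* Defs.v *)
From HB Require Import structures.
From mathcomp Require Import all_boot all_algebra.
From mathcomp Require Import generic_quotient ring_quotient.
From mathcomp.multinomials Require Import mpoly.

Set Implicit Arguments.
Unset Strict Implicit.
Unset Printing Implicit Defensive.

Import GRing.Theory.
Local Open Scope ring_scope.
Local Open Scope quotient_scope.

Section SubmoduleType.
Variables (R : nzRingType) (M : lmodType R) (I : submodClosed M).

Record submod_of := SubmodOf { submod_val : M; _ : submod_val \in I }.

HB.instance Definition _ := [isSub for submod_val].
HB.instance Definition _ := [Choice of submod_of by <:].
HB.instance Definition _ := [SubChoice_isSubLmodule of submod_of by <:].

End SubmoduleType.

Section QuotientModule.
Variables (R : nzRingType) (M : lmodType R) (J : submodClosed M).

(* submodClosed does not inherit from zmodClosed, which Quotient.quot needs. *)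
Definition submod_zpred : {pred M} := fun x => x \in J.

Fact submod_zpred_closed : zmod_closed submod_zpred.
Proof. exact: (submodClosedP J). Qed.

HB.instance Definition _ :=
  GRing.isZmodClosed.Build M submod_zpred submod_zpred_closed.

Definition quot_mod := Quotient.quot submod_zpred.

HB.instance Definition _ := GRing.Zmodule.on quot_mod.
HB.instance Definition _ := ZmodQuotient.on quot_mod.

Definition quot_mod_scale (a : R) := lift_op1 quot_mod ( *:%R a).

Lemma pi_quot_mod_scale (a : R) :
  {morph \pi_quot_mod : x / a *: x >-> quot_mod_scale a x}.
Proof.
move=> x; unlock quot_mod_scale; apply/eqP; rewrite piE Quotient.equivE.
rewrite -scalerBr unfold_in rpredZ //.
by rewrite -[_ \in J]/(_ \in submod_zpred) Quotient.idealrBE reprK.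
Qed.

Canonical pi_quot_mod_scale_morph a := PiMorph1 (pi_quot_mod_scale a).

Fact quot_mod_scalerA a b v :
  quot_mod_scale a (quot_mod_scale b v) = quot_mod_scale (a * b) v.
Proof. by rewrite -[v]reprK !piE scalerA. Qed.

Fact quot_mod_scale1r : left_id 1 quot_mod_scale.
Proof. by move=> v; rewrite -[v]reprK !piE scale1r. Qed.

Fact quot_mod_scalerDr : right_distributive quot_mod_scale +%R.
Proof. by move=> a u v; rewrite -[u]reprK -[v]reprK !piE scalerDr. Qed.

Fact quot_mod_scalerDl v : {morph quot_mod_scale^~ v : a b / a + b}.
Proof. by move=> a b; rewrite -[v]reprK !piE scalerDl. Qed.

HB.instance Definition _ := GRing.Zmodule_isLmodule.Build R quot_mod
  quot_mod_scalerA quot_mod_scale1r quot_mod_scalerDr quot_mod_scalerDl.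

Lemma pi_quot_modZ (a : R) (x : M) :
  \pi_quot_mod (a *: x) = a *: \pi_quot_mod x.
Proof. exact: pi_quot_mod_scale. Qed.

Lemma pi_quot_modD (x y : M) :
  \pi_quot_mod (x + y) = \pi_quot_mod x + \pi_quot_mod y.
Proof. by rewrite piE. Qed.

Lemma pi_quot_mod_eq0 (x : M) : (\pi_quot_mod x == 0) = (x \in J).
Proof. by rewrite piE Quotient.equivE subr0. Qed.

End QuotientModule.

Section Subquotient.
Variables (R : nzRingType) (M : lmodType R) (I J : submodClosed M).

Definition submod_trace : {pred submod_of I} := fun u => val u \in J.

Fact submod_trace_closed : submod_closed submod_trace.
Proof.
split; first by rewrite unfold_in raddf0 rpred0.
move=> a u v uJ vJ; rewrite -[_ \in _]/(val (a *: u + v) \in J) linearP.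
by rewrite rpredD // rpredZ.
Qed.

HB.instance Definition _ :=
  GRing.isSubmodClosed.Build R (submod_of I) submod_trace submod_trace_closed.

(* The R-module I / (I :&: J), i.e. I / J when J is contained in I. *)
Definition subquot : lmodType R := quot_mod submod_trace.

End Subquotient.

Section Generation.
Variables (R : nzRingType) (M : lmodType R).

Definition in_span (A : M -> Prop) (x : M) : Prop :=
  exists (k : nat) (c : 'I_k -> R) (v : 'I_k -> M),
    (forall i, A (v i)) /\ x = \sum_(i < k) c i *: v i.

Definition generated_by (A : M -> Prop) (N : submodClosed M) : Prop :=
  forall x : M, x \in N <-> in_span A x.

End Generation.

Section Depth.
Variables (R : comNzRingType) (M : lmodType R).

(* x lies in (a_1, ..., a_r) M. *)
Definition in_seq_mul (a : seq R) (x : M) : Prop :=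
  exists y : 'I_(size a) -> M, x = \sum_(i < size a) a`_i *: y i.

(* Each a_i is a nonzerodivisor on M / (a_1, ..., a_(i-1)) M, and
   M / (a_1, ..., a_r) M is nonzero. *)
Definition regular_seq (a : seq R) : Prop :=
  (forall i : nat, (i < size a)%N ->
     forall x : M, in_seq_mul (take i a) (a`_i *: x) ->
       in_seq_mul (take i a) x)
  /\ exists x : M, ~ in_seq_mul a x.

(* k is the maximal length of an M-regular sequence of elements of P. *)
Definition is_depth (P : R -> Prop) (k : nat) : Prop :=
  (exists a : seq R,
     [/\ size a = k, forall r, r \in a -> P r & regular_seq a])
  /\ (forall a : seq R,
        (forall r, r \in a -> P r) -> regular_seq a -> (size a <= k)%N).

End Depth.

Section MonomialIdeals.
Variables (K : fieldType) (n : nat).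

(* Ideals of S are the submodules of the regular module S^o. *)
Local Notation ideal := (submodClosed {mpoly K[n]}^o).

Definition graded_max_ideal (p : {mpoly K[n]}) : Prop :=
  in_span (fun q : {mpoly K[n]}^o => exists i : 'I_n, q = 'X_i) p.

Definition squarefree (m : 'X_{1..n}) : bool := [forall i, (m i <= 1)%N].

Definition sqfree_monomial_ideal_gen_ge (e : nat) (J : ideal) : Prop :=
  exists G : 'X_{1..n} -> Prop,
    (forall m, G m -> squarefree m /\ (e <= mdeg m)%N) /\
    generated_by (fun q : {mpoly K[n]}^o => exists2 m, G m & q = 'X_[m]) J.

Definition rho (j : nat) (I J : ideal) : nat :=
  #|[set m : 'X_{1..n < j.+1} |
      [&& mdeg m == j, squarefree m,
          ('X_[m] : {mpoly K[n]}^o) \in I &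
          ('X_[m] : {mpoly K[n]}^o) \notin J]]|.

End MonomialIdeals.

(* Main.v *)
Require Import Defs.
From mathcomp Require Import all_boot all_algebra.
From mathcomp Require Import generic_quotient.
From mathcomp.multinomials Require Import mpoly.

(** Why the theorem holds.  Dividing by f identifies I / J with S / (J : f), and
    J : f is a square free monomial ideal in the variables outside f, that is,
    the Stanley-Reisner ideal of a simplicial complex D on those variables,
    extended to S by the d variables of f as free variables.  The numbers
    rho_(d+1) and rho_(d+2) count the vertices and the edges of D
    ([rho_faces]).  A connected graph has at most one vertex more than it has
    edges, so the hypothesis makes D disconnected ([few_edges_disconnected]), and a
    disconnected complex has a face ring of depth one; the d free variables add
    d to the depth.

    Concretely, the d variables of f followed by theta, the sum of the remaining
    variables, form a regular sequence a on I / J ([vars_regular],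
    [theta_regular]).  If W is a set of vertices of D that no edge joins to the
    remaining vertices, and z is the sum over i in W of x_i f, then every
    variable maps z into a (I / J): for j in W, x_j z = theta x_j f since
    x_j x_i f vanishes for i outside W, and x_j z = 0 for the other j outside f.
    But z is not in a (I / J) when W and its complement contain vertices, since
    the coefficient of x_i f is the same for all vertices i in every element of
    theta (I / J), up to multiples of the variables of f, while z has
    coefficient 1 on W and 0 off W ([depth_of_separation]).

    It remains to see that a regular sequence a for which M / a M has such a
    nonzero socle element z has the maximal length ([is_depth_socle]).  This is
    Rees' theorem, proved with the Koszul cohomology H^i(M) of generators of the
    ideal.  Every element of the ideal acts on the Koszul complex by a map
    homotopic to zero.  A regular sequence of length r in the ideal therefore
    forces H^i(M) = 0 for i < r ([regular_kexact]).  Conversely, if H^i(M)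
    vanishes for all i <= size a, then H^0(M / a M), which is the socle of
    M / a M, vanishes ([kexact_quot]). *)

Set Implicit Arguments.
Unset Strict Implicit.
Unset Printing Implicit Defensive.

Import GRing.Theory.

(** * Koszul cohomology and Rees' theorem *)

Section Koszul.
Local Open Scope ring_scope.
Variables (R : comNzRingType) (M : lmodType R).

(** The underlying module of the Koszul cochain complex of s, built as an iterated
    mapping cone: adding x to s gives the cone of multiplication by x, so that no
    exterior algebra and no sign rule for subsets occurs. *)
Fixpoint koszul (s : seq R) : lmodType R :=
  if s is _ :: s' then (koszul s' * koszul s')%type else M.

Fixpoint kdiff (s : seq R) : koszul s -> koszul s :=
  match s with
  | [::] => fun _ => 0
  | x :: s' => fun u => (kdiff u.1, x *: u.1 - kdiff u.2)
  end.

(** [kdeg i u] says that u is homogeneous of cohomological degree i - 1.  With this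
    shift, 0 is the only element for i = 0, and since [0.-1 = 0] the statements
    that lower the degree need no case distinction. *)
Fixpoint kdeg (s : seq R) (i : nat) : koszul s -> Prop :=
  match s with
  | [::] => fun u => i <> 1%N -> u = 0
  | _ :: _ => fun u => kdeg i u.1 /\ kdeg i.-1 u.2
  end.

(** The subcomplex of the cochains whose coefficients lie in N.  The complex of the
    quotient M / N is handled as the complex of M modulo [kcoef N], which avoids
    forming the successive quotients of a regular sequence. *)
Fixpoint kcoef (N : M -> Prop) (s : seq R) : koszul s -> Prop :=
  match s with
  | [::] => N
  | _ :: _ => fun u => kcoef N u.1 /\ kcoef N u.2
  end.

Fixpoint kconst (s : seq R) (z : M) : koszul s :=
  match s with
  | [::] => z
  | _ :: s' => (kconst s' z, 0)
  end.

Lemma kdiff_linear s a (u v : koszul s) : kdiff (a *: u + v) = a *: kdiff u + kdiff v.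
Proof.
elim: s u v => [|x s IH] u v /=; first by rewrite scaler0 addr0.
rewrite -[RHS]/(_, _) /= !IH; congr (_, _).
by rewrite scalerDr scalerBr !scalerA [x * a]mulrC opprD addrACA.
Qed.

Lemma kdiff0 s : kdiff (0 : koszul s) = 0.
Proof.
have := kdiff_linear (-1) (0 : koszul s) 0.
by rewrite scaleN1r addr0 oppr0 scaleN1r addNr.
Qed.

Lemma kdiffZ s a (u : koszul s) : kdiff (a *: u) = a *: kdiff u.
Proof. by rewrite -[a *: u]addr0 kdiff_linear kdiff0 addr0. Qed.

Lemma kdiffD s (u v : koszul s) : kdiff (u + v) = kdiff u + kdiff v.
Proof. by rewrite -[u]scale1r kdiff_linear !scale1r. Qed.

Lemma kdiffB s (u v : koszul s) : kdiff (u - v) = kdiff u - kdiff v.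
Proof. by rewrite kdiffD -scaleN1r kdiffZ scaleN1r. Qed.

Lemma kdiffK s (u : koszul s) : kdiff (kdiff u) = 0.
Proof.
elim: s u => [|x s IH] u //=.
by rewrite kdiffB kdiffZ !IH subr0 subrr.
Qed.

Lemma kdeg0 s i : kdeg i (0 : koszul s).
Proof. by elim: s i => [|x s IH] i /=. Qed.

Lemma kdeg_linear s i a (u v : koszul s) : kdeg i u -> kdeg i v -> kdeg i (a *: u + v).
Proof.
elim: s i u v => [|x s IH] i u v /=.
  by move=> Hu Hv /[dup]/Hu-> /Hv->; rewrite scaler0 addr0.
by move=> [? ?] [? ?]; split; apply: IH.
Qed.

Lemma kdegZ s i a (u : koszul s) : kdeg i u -> kdeg i (a *: u).
Proof. by move=> Hu; rewrite -[a *: u]addr0; apply: kdeg_linear => //; apply: kdeg0. Qed.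

Lemma kdegB s i (u v : koszul s) : kdeg i u -> kdeg i v -> kdeg i (u - v).
Proof. by move=> Hu Hv; rewrite addrC -scaleN1r; apply: kdeg_linear. Qed.

Lemma kdeg_eq0 s (u : koszul s) : kdeg 0 u -> u = 0.
Proof.
elim: s u => [|x s IH] u /=; first by apply.
by case: u => u v /= [/IH-> /IH->].
Qed.

Lemma kdeg_diff s i (u : koszul s) : kdeg i u -> kdeg i.+1 (kdiff u).
Proof.
elim: s i u => [|x s IH] i u //= [Hu Hv]; split; first exact: IH.
apply: kdegB; first exact: kdegZ.
by case: i Hu Hv => [|i] Hu /= Hv; [rewrite (kdeg_eq0 Hv) kdiff0; apply: kdeg0 | apply: IH].
Qed.

Lemma kdeg_const s z : kdeg 1 (kconst s z).
Proof. by elim: s => [|x s IH] //=; split=> //; apply: kdeg0. Qed.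

Definition is_submod (N : M -> Prop) :=
  N 0 /\ forall a x y, N x -> N y -> N (a *: x + y).

Section Coef.
Variables (N : M -> Prop) (HN : is_submod N).

Lemma kcoef0 s : kcoef N (0 : koszul s).
Proof. by elim: s => [|x s IH] //=; case: HN. Qed.

Lemma kcoef_linear s a (u v : koszul s) : kcoef N u -> kcoef N v -> kcoef N (a *: u + v).
Proof.
elim: s u v => [|x s IH] u v /=; first by case: HN => _; apply.
by move=> [? ?] [? ?]; split; apply: IH.
Qed.

Lemma kcoefZ s a (u : koszul s) : kcoef N u -> kcoef N (a *: u).
Proof. by move=> Hu; rewrite -[a *: u]addr0; apply: kcoef_linear => //; apply: kcoef0. Qed.

Lemma kcoefD s (u v : koszul s) : kcoef N u -> kcoef N v -> kcoef N (u + v).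
Proof. by move=> Hu Hv; rewrite -[u]scale1r; apply: kcoef_linear. Qed.

Lemma kcoefB s (u v : koszul s) : kcoef N u -> kcoef N v -> kcoef N (u - v).
Proof. by move=> Hu Hv; rewrite addrC -scaleN1r; apply: kcoef_linear. Qed.

Lemma kcoef_diff s (u : koszul s) : kcoef N u -> kcoef N (kdiff u).
Proof.
elim: s u => [|x s IH] u /=; first by case: HN.
by move=> [? ?]; split; [apply: IH | apply: kcoefB; [apply: kcoefZ | apply: IH]].
Qed.

Lemma kcoef_reg s a (u : koszul s) : (forall x, N (a *: x) -> N x) ->
  kcoef N (a *: u) -> kcoef N u.
Proof.
move=> reg; elim: s u => [|x s IH] u /=; first exact: reg.
by move=> [? ?]; split; apply: IH.
Qed.

Lemma kcoef_const s z : kcoef N (kconst s z) -> N z.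
Proof. by elim: s => //= x s IH [/IH]. Qed.

(** In degree zero the differential multiplies by the elements of s, so an element
    killed by s modulo N is a cocycle modulo N. *)
Lemma kcoef_diff_const s z : (forall x, x \in s -> N (x *: z)) ->
  kcoef N (kdiff (kconst s z)).
Proof.
have kc x t : N (x *: z) -> kcoef N (x *: kconst t z).
  by move=> Nz; elim: t => [|y t IH] //=; split=> //=; rewrite scaler0; apply: kcoef0.
elim: s => [|x s IH] /= Hs; first by case: HN.
split; first by apply: IH => y ys; apply: Hs; rewrite inE ys orbT.
by rewrite kdiff0 subr0; apply: kc; apply: Hs; rewrite inE eqxx.
Qed.

End Coef.

(** Multiplication by a is homotopic to zero on the Koszul complex.  The homotopy is
    required to preserve coefficients in every submodule, so that it also works
    modulo N. *)
Definition null_homotopic (s : seq R) (a : R) :=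
  exists h : koszul s -> koszul s,
    [/\ forall b u v, h (b *: u + v) = b *: h u + h v,
        forall i u, kdeg i u -> kdeg i.-1 (h u),
        forall N, is_submod N -> forall u, kcoef N u -> kcoef N (h u) &
        forall u, kdiff (h u) + h (kdiff u) = a *: u].

(** For the head x of the sequence the homotopy is the projection of the mapping
    cone; for a later element it is the homotopy of the tail, with the sign that
    the shifted summand of the cone asks for. *)
Lemma null_homotopic_mem (s : seq R) x : x \in s -> null_homotopic s x.
Proof.
elim: s => [|y s IH] //; rewrite inE => /predU1P[<-{y} | /IH [h [hP hdeg hN hh]]].
  exists (fun u : koszul (x :: s) => (u.2, 0)); split=> /=.
  - by move=> b u v; congr (_, _); rewrite /= scaler0 addr0.
  - by move=> i u [_ Hu]; split=> //; apply: kdeg0.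
  - by move=> N HN u [_ Hu]; split=> //; apply: kcoef0.
  - move=> [u v] /=; rewrite kdiff0 subr0; congr (_, _) => /=; last by rewrite addr0.
    by rewrite addrC subrK.
have h0 : h 0 = 0.
  by have := hP (-1) 0 0; rewrite scaleN1r addr0 oppr0 scaleN1r addNr.
have hZ b u : h (b *: u) = b *: h u by rewrite -[b *: u]addr0 hP h0 addr0.
have hB u v : h (u - v) = h u - h v by rewrite addrC -scaleN1r hP scaleN1r addrC.
exists (fun u : koszul (y :: s) => (h u.1, - h u.2)); split=> /=.
- move=> b u v; congr (_, _) => /=; first exact: hP.
  by rewrite hP opprD scalerN.
- move=> i u [Hu Hv]; split; first exact: hdeg.
  by rewrite -scaleN1r; apply: kdegZ; apply: hdeg.
- move=> N HN u [Hu Hv]; split; first exact: hN.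
  by rewrite -scaleN1r; apply: kcoefZ => //; apply: hN.
- move=> [u v] /=; congr (_, _) => /=; first exact: hh.
  rewrite -[- h v]scaleN1r kdiffZ scaleN1r opprK hB hZ opprB addrC addrA subrK.
  by rewrite addrC hh.
Qed.

Lemma null_homotopic_span (s : seq R) a :
  in_span (fun q : R^o => q \in s) a -> null_homotopic s a.
Proof.
move=> [k [c [v [Hv ->]]]].
elim/big_ind: _ => [||i _].
- exists (fun=> 0); split.
  + by move=> b _ _; rewrite scaler0 addr0.
  + by move=> *; apply: kdeg0.
  + by move=> *; apply: kcoef0.
  + by move=> u; rewrite kdiff0 addr0 scale0r.
- move=> x y [h [hP hd hN hh]] [g [gP gd gN gh]].
  exists (fun u => h u + g u); split.
  + by move=> b u w; rewrite hP gP scalerDr addrACA.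
  + move=> i u Hu; rewrite -[h u]scale1r; apply: kdeg_linear; [exact: hd | exact: gd].
  + by move=> N HN u Hu; apply: kcoefD => //; [apply: hN | apply: gN].
  + by move=> u; rewrite kdiffD addrACA hh gh scalerDl.
- have [h [hP hd hN hh]] := null_homotopic_mem (Hv i).
  exists (fun u => c i *: h u); split.
  + by move=> b u w; rewrite hP scalerDr !scalerA mulrC.
  + by move=> j u Hu; apply: kdegZ; apply: hd.
  + by move=> N HN u Hu; apply: kcoefZ => //; apply: hN.
  + by move=> u; rewrite kdiffZ -scalerDr hh scalerA.
Qed.

(** Vanishing of the Koszul cohomology of M / N in degree i - 1. *)
Definition kexact (s : seq R) (N : M -> Prop) (i : nat) :=
  forall u : koszul s, kdeg i u -> kcoef N (kdiff u) ->
    exists2 w, kdeg i.-1 w & kcoef N (u - kdiff w).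

Section Step.
Variables (s : seq R) (N : M -> Prop) (a : R).
Hypothesis HN : is_submod N.
Hypothesis regN : forall x, N (a *: x) -> N x.

Let N' x := exists v, N (x - a *: v).

(** A cochain with coefficients in N + a M is a multiple of a modulo N; the point is
    that the cofactor v can be chosen in the same degree. *)
Lemma kcoef_lift i (u : koszul s) : kdeg i u -> kcoef N' u ->
  exists2 v, kdeg i v & kcoef N (u - a *: v).
Proof.
elim: s i u => [|x t IH] i u /=.
  move=> Hi [v Hv]; case: (i =P 1%N) => [-> | /[dup] ni /Hi u0]; first by exists v.
  by exists 0 => //; rewrite u0 scaler0 subr0; case: HN.
move=> [d1 d2] [c1 c2].
have [v1 ? ?] := IH _ _ d1 c1; have [v2 ? ?] := IH _ _ d2 c2.
by exists (v1, v2).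
Qed.

Lemma kcoef_step (u v : koszul s) : kcoef N (u - a *: v) -> kcoef N' u.
Proof.
elim: s u v => [|x t IH] u v /=; first by exists v.
by move=> [/IH ? /IH ?].
Qed.

(** Since a acts as zero on cohomology, the long exact sequence of multiplication by a
    on M / N makes the connecting map H^(i-1)(M / N') -> H^i(M / N) surjective.  On
    cochains: a cocycle u has a u = d (h u) modulo N, so h u is a cocycle modulo N';
    if h u = d w + a v modulo N, then a u = a d v modulo N. *)
Lemma kexact_of_quot i : null_homotopic s a -> kexact s N' i -> kexact s N i.+1.
Proof.
move=> [h [hP hdeg hN hh]] ex u du cu.
have dhu : kdeg i (h u) by exact: hdeg du.
have E : kdiff (h u) = a *: u - h (kdiff u) by rewrite -hh addrK.
have cdhu : kcoef N (kdiff (h u) - a *: u).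
  by rewrite E addrC addKr -scaleN1r; apply: kcoefZ => //; apply: hN.
have [w dw cw] := ex _ dhu (kcoef_step cdhu).
have dw' : kdeg i (h u - kdiff w).
  apply: kdegB => //; case: (i) dw => [|j] /=; last exact: kdeg_diff.
  by move/kdeg_eq0->; rewrite kdiff0; apply: kdeg0.
have [v dv cv] := kcoef_lift dw' cw.
(* Cancelling a, it suffices that a (u - d v) lies in N. *)
exists v => //; apply: (kcoef_reg regN).
have /(kcoef_diff HN) := cv; rewrite !kdiffB kdiffZ kdiffK subr0 => cv'.
rewrite scalerBr.
have -> : a *: u - a *: kdiff v = (kdiff (h u) - a *: kdiff v) - (kdiff (h u) - a *: u).
  by rewrite opprB addrC [RHS]addrC addrA subrK addrC.
exact: kcoefB.
Qed.

(** The part H^i(M / N) -> H^i(M / N') -> H^(i+1)(M / N) of the long exact sequence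
    of multiplication by a on M / N. *)
Lemma kexact_quot_step i : kexact s N i -> kexact s N i.+1 -> kexact s N' i.
Proof.
move=> ex0 ex1 u du cu.
have [v dv cv] := kcoef_lift (kdeg_diff du) cu.
have cdv : kcoef N (kdiff v).
  have /(kcoef_diff HN) := cv; rewrite kdiffB kdiffZ kdiffK sub0r -scalerN => /(kcoef_reg regN).
  by move/(kcoefZ HN (-1)); rewrite scaleN1r opprK.
have [w dw cw] := ex1 _ dv cdv.
have [|w' dw' cw'] := ex0 _ (kdegB du (kdegZ a dw)).
  rewrite kdiffB kdiffZ.
  have -> : kdiff u - a *: kdiff w = (kdiff u - a *: v) + a *: (v - kdiff w).
    by rewrite scalerBr addrA subrK.
  by apply: kcoefD => //; apply: kcoefZ.
exists w' => //; apply: (@kcoef_step _ w).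
by rewrite addrAC.
Qed.

End Step.

(** Indexing the cofactors by natural numbers makes them independent of the length of
    the sequence, which [in_seq_mul_rcons] changes. *)
Lemma in_seq_mulP (a : seq R) (x : M) :
  in_seq_mul a x <-> exists y : nat -> M, x = \sum_(i < size a) a`_i *: y i.
Proof.
split=> [[y ->] | [y ->]]; last by exists (fun i => y i).
exists (fun k => if insub k is Some i then y i else 0).
by apply: eq_bigr => i _; rewrite valK.
Qed.

Lemma in_seq_mul_rcons (a : seq R) b (x : M) :
  in_seq_mul (rcons a b) x <-> exists v, in_seq_mul a (x - b *: v).
Proof.
split=> [/in_seq_mulP[y ->] | [v /in_seq_mulP[y E]]].
  exists (y (size a)); apply/in_seq_mulP; exists y.
  rewrite size_rcons big_ord_recr /= nth_rcons ltnn eqxx addrK.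
  by apply: eq_bigr => i _; rewrite nth_rcons ltn_ord.
apply/in_seq_mulP; exists (fun i => if i == size a then v else y i).
rewrite size_rcons big_ord_recr /= nth_rcons ltnn !eqxx -[LHS](subrK (b *: v)) E.
by congr (_ + _); apply: eq_bigr => i _; rewrite nth_rcons ltn_ord ltn_eqF.
Qed.

Lemma in_seq_mul_nil (x : M) : in_seq_mul [::] x <-> x = 0.
Proof. by split=> [[y ->]|->]; rewrite ?big_ord0 //; exists (fun=> 0); rewrite big_ord0. Qed.

Lemma in_seq_mul_submod (a : seq R) : is_submod (in_seq_mul a).
Proof.
split; first by exists (fun=> 0); rewrite big1 // => i _; rewrite scaler0.
move=> c x y [u ->] [v ->]; exists (fun i => c *: u i + v i).
rewrite scaler_sumr -big_split; apply: eq_bigr => i _ /=.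
by rewrite scalerDr !scalerA mulrC.
Qed.

Lemma in_seq_mul_mem (a : seq R) b (x : M) : b \in a -> in_seq_mul a (b *: x).
Proof.
move=> ba; have ia : (index b a < size a)%N by rewrite index_mem.
exists (fun i => if i == Ordinal ia then x else 0).
rewrite (bigD1 (Ordinal ia)) //= eqxx nth_index // big1 ?addr0 // => i /negbTE->.
by rewrite scaler0.
Qed.

Lemma kexact_ext s (N N' : M -> Prop) i : (forall x, N x <-> N' x) ->
  kexact s N i -> kexact s N' i.
Proof.
move=> NN'; have cE t (u : koszul t) : kcoef N u <-> kcoef N' u.
  by elim: t u => [|x t IH] u /=; [apply: NN' | rewrite !IH].
by move=> ex u du /cE/ex-/(_ du)[w dw /cE cw]; exists w.
Qed.

(** The vanishing for M / (a_1, ..., a_(r-k)) M in the k lowest degrees, by induction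
    on k: each step removes the last element of the regular sequence and gains one
    degree by [kexact_of_quot]. *)
Lemma regular_kexact s a : {in a, forall r, null_homotopic s r} -> regular_seq M a ->
  forall i, (i <= size a)%N -> kexact s (in_seq_mul (M := M) [::]) i.
Proof.
move=> ha [reg _].
suff H k : (k <= size a)%N -> forall i, (i <= k)%N ->
    kexact s (in_seq_mul (M := M) (take (size a - k) a)) i.
  by move=> i ia; have := H _ (leqnn _) _ ia; rewrite subnn take0.
elim: k => [_ i|k IH ka i].
  rewrite leqn0 => /eqP-> u /kdeg_eq0-> _; exists 0; rewrite ?kdiff0 ?subr0; first exact: kdeg0.
  by apply: kcoef0; apply: in_seq_mul_submod.
case: i => [_ u /kdeg_eq0-> _|i ik].
  exists 0; rewrite ?kdiff0 ?subr0; first exact: kdeg0.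
  by apply: kcoef0; apply: in_seq_mul_submod.
set j := (size a - k.+1)%N.
have ja : (j < size a)%N by rewrite /j -subSn ?leq_subr // subSS leq_subr.
apply: (kexact_of_quot (a := a`_j)).
- exact: in_seq_mul_submod.
- exact: reg.
- by apply: ha; apply: mem_nth.
apply: kexact_ext (IH (ltnW ka) i ik) => x.
have -> : (size a - k = j.+1)%N by rewrite /j subnSK.
by rewrite (take_nth 0) // in_seq_mul_rcons.
Qed.

(** Each element of the regular sequence costs one degree, by [kexact_quot_step], and only
    degree zero is left at the end. *)
Lemma kexact_quot s a : regular_seq M a ->
  (forall i, (i <= (size a).+1)%N -> kexact s (in_seq_mul (M := M) [::]) i) ->
  kexact s (in_seq_mul (M := M) a) 1.
Proof.
move=> [reg _] ex.
suff H k : (k <= size a)%N -> forall i, (i + k <= (size a).+1)%N ->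
    kexact s (in_seq_mul (M := M) (take k a)) i.
  by have := H _ (leqnn _) 1%N; rewrite take_size; apply.
elim: k => [_ i|k IH ka i ik]; first by rewrite take0 addn0; apply: ex.
apply: (@kexact_ext _ (fun x => exists v, in_seq_mul (take k a) (x - a`_k *: v))).
  by move=> x; rewrite (take_nth 0) // in_seq_mul_rcons.
rewrite addnS in ik; apply: kexact_quot_step.
- exact: in_seq_mul_submod.
- exact: reg.
- exact: IH (ltnW ka) _ (ltnW ik).
- exact: IH (ltnW ka) i.+1 ik.
Qed.

(** A regular sequence b longer than a would kill the Koszul cohomology of M up to
    degree [size a], hence the socle of M / a M, which contains the class of z. *)
Theorem is_depth_socle (P : R -> Prop) (s a : seq R) (z : M) :
    (forall r, P r -> in_span (fun q : R^o => q \in s) r) ->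
    (forall r, r \in a -> P r) ->
    (forall i, (i < size a)%N -> forall x : M,
       in_seq_mul (take i a) (a`_i *: x) -> in_seq_mul (take i a) x) ->
    (forall x, x \in s -> in_seq_mul a (x *: z)) -> ~ in_seq_mul a z ->
  is_depth M P (size a).
Proof.
move=> Ps aP reg sz nz; have rega : regular_seq M a by split; last by exists z.
split=> [|b bP regb]; first by exists a.
rewrite leqNgt; apply/negP => ab; apply: nz.
have ex : kexact s (in_seq_mul (M := M) a) 1.
  apply: kexact_quot rega _ => i ia; apply: regular_kexact regb _ (leq_trans ia ab).
  by move=> r /bP/Ps; apply: null_homotopic_span.
have [w /= /kdeg_eq0->] :=
  ex _ (kdeg_const s z) (kcoef_diff_const (in_seq_mul_submod a) sz).
by rewrite kdiff0 subr0 => /kcoef_const.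
Qed.

End Koszul.

(** * Coefficients and monomial ideals *)

Section Monomials.
Local Open Scope ring_scope.
Variables (K : fieldType) (n : nat).
Local Notation S := {mpoly K[n]}.

Lemma mcoeffXM (k m : 'X_{1..n}) (p : S) :
  ('X_[k] * p)@_m = if (k <= m)%MM then p@_(m - k) else 0.
Proof.
rewrite mulrC; case: ifP => [km | nkm]; first by rewrite -[in LHS](submK km) addmC mcoeffMX.
apply: memN_msupp_eq0; rewrite (perm_mem (msuppMX p k)); apply/mapP => -[m' _ E].
by rewrite E lem_addr in nkm.
Qed.

Lemma mcoeff_filter (P : pred 'X_{1..n}) (p : S) k :
  (\sum_(m <- msupp p | P m) p@_m *: 'X_[m])@_k = if P k then p@_k else 0.
Proof.
rewrite big_mkcond [in RHS](mpolyE p) !raddf_sum /=.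
case: ifP => Pk; first apply: eq_bigr => m _; last rewrite big1 // => m _.
  case: ifP => Pm //; rewrite mcoeff0 mcoeffZ mcoeffX.
  by case: eqVneq => [mk|]; rewrite ?mulr0 //; rewrite mk Pk in Pm.
case: ifP => Pm; rewrite ?mcoeff0 // mcoeffZ mcoeffX.
by case: eqVneq => [mk|]; rewrite ?mulr0 //; rewrite mk Pk in Pm.
Qed.

Lemma monomial_idealP (A : S^o -> Prop) (G : 'X_{1..n} -> Prop) (J : submodClosed S^o) :
    (forall q, A q <-> exists2 g, G g & q = 'X_[g]) -> generated_by A J ->
  forall p : S^o, p \in J <->
    forall m, (p : S)@_m != 0 -> exists2 g, G g & (g <= m)%MM.
Proof.
move=> AG JA p; split.
  move=> /JA [k [c [v [Av ->]]]] m; rewrite raddf_sum /=.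
  have [i ne0 _|all0] := pickP (fun i : 'I_k => (c i *: v i : S)@_m != 0); last first.
    by rewrite big1 ?eqxx // => i _; apply/eqP/negbFE/all0.
  have /AG[g Gg vE] := Av i; exists g => //; move: ne0; rewrite vE.
  by rewrite -[_ *: _]/(c i * 'X_[g]) mulrC mcoeffXM; case: ifP; rewrite ?eqxx.
move=> H; rewrite [p]mpolyE big_seq; apply: rpred_sum => m.
rewrite mcoeff_msupp => /H[g Gg gm].
have -> : (p : S)@_m *: 'X_[m] = (((p : S)@_m *: 'X_[m - g] : S) *: ('X_[g] : S^o) : S^o).
  by rewrite -[RHS]/(_ * _) -scalerAl -mpolyXD submK.
apply: rpredZ; apply/JA; exists 1%N, (fun=> 1), (fun=> 'X_[g]).
by split; [move=> _; apply/AG; exists g | rewrite big_ord1 scale1r].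
Qed.
End Monomials.

(** * The depth of I / J for a disconnected complex *)

Section Subquotient.
Local Open Scope ring_scope.
Local Open Scope quotient_scope.
Variables (K : fieldType) (n : nat).
Local Notation S := {mpoly K[n]}.
Variables (I J : submodClosed S^o) (f : 'X_{1..n}).
Local Notation jm m := (('X_[m] : S^o) \in J).

(** The hypotheses state, in terms of exponents, that I is generated by f and J is a
    square free monomial ideal not containing f; [jm_sqf] is the square freeness:
    multiplying a monomial by a variable that divides it cannot bring it into J. *)
Hypothesis memI : forall p : S^o, p \in I <-> forall m, (p : S)@_m != 0 -> (f <= m)%MM.
Hypothesis memJ : forall p : S^o, p \in J <-> forall m, (p : S)@_m != 0 -> jm m.
Hypothesis jm_up : forall m m' : 'X_{1..n}, (m <= m')%MM -> jm m -> jm m'.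
Hypothesis jm_sqf : forall (m : 'X_{1..n}) i, m i != 0%N -> jm (m + U_(i))%MM -> jm m.
Hypothesis jm_f : ~~ jm f.

Local Notation M := (subquot I J).

Definition cls (u : submod_of I) : M := \pi_(quot_mod (submod_trace (I := I) J)) u.
Definition rep (x : M) : submod_of I := repr (x : quot_mod (submod_trace (I := I) J)).

Lemma repK x : cls (rep x) = x. Proof. exact: reprK. Qed.
Lemma clsD u v : cls (u + v) = cls u + cls v. Proof. exact: pi_quot_modD. Qed.
Lemma clsZ a u : cls (a *: u) = a *: cls u. Proof. exact: pi_quot_modZ. Qed.
Lemma cls_eq0 u : (cls u == 0) = (val u \in J). Proof. exact: pi_quot_mod_eq0. Qed.

Lemma valD (u v : submod_of I) : (val (u + v) : S) = val u + val v.
Proof. exact: raddfD. Qed.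
Lemma valB (u v : submod_of I) : (val (u - v) : S) = val u - val v.
Proof. exact: (raddfB (val : {additive submod_of I -> S^o})). Qed.
Lemma valZ a (u : submod_of I) : (val (a *: u) : S) = a * val u.
Proof. exact: (linearZZ (val : {linear submod_of I -> S^o})). Qed.

(** The coefficient of a monomial in a class of I / J.  The monomials in I but not in J
    form a basis of I / J over the field; on the other monomials [cf] is zero. *)
Definition cf (x : M) (m : 'X_{1..n}) : K := if jm m then 0 else (val (rep x) : S)@_m.

Lemma cf_cls u m : cf (cls u) m = if jm m then 0 else (val u : S)@_m.
Proof.
rewrite /cf; case: ifP => // njm.
have : val (rep (cls u) - u) \in J.
  by rewrite -cls_eq0 clsD repK -scaleN1r clsZ scaleN1r subrr.
move=> /memJ /(_ m); rewrite valB mcoeffB njm => H.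
by apply/eqP; rewrite -subr_eq0; apply/negP => /negP/H.
Qed.

Lemma cfD x y m : cf (x + y) m = cf x m + cf y m.
Proof.
rewrite -[x]repK -[y]repK -clsD !cf_cls valD mcoeffD.
by case: ifP; rewrite ?addr0.
Qed.

Lemma cf0 m : cf 0 m = 0.
Proof. by apply: (addrI (cf 0 m)); rewrite -cfD !addr0. Qed.
Lemma cfN x m : cf (- x) m = - cf x m.
Proof. by apply: (addrI (cf x m)); rewrite -cfD !subrr cf0. Qed.
Lemma cf_sum (A : Type) (r : seq A) (P : pred A) (F : A -> M) m :
  cf (\sum_(i <- r | P i) F i) m = \sum_(i <- r | P i) cf (F i) m.
Proof. by apply: (big_morph (cf^~ m)) => [x y|]; [apply: cfD | apply: cf0]. Qed.

Lemma cf_inj x : (forall m, cf x m = 0) -> x = 0.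
Proof.
move=> H; apply/eqP; rewrite -[x]repK cls_eq0; apply/memJ => m.
by have := H m; rewrite /cf; case: ifP => // _ ->; rewrite eqxx.
Qed.

Lemma cf_supp x m : cf x m != 0 -> (f <= m)%MM.
Proof.
rewrite /cf; case: ifP; rewrite ?eqxx // => _.
by move: m; apply/memI; apply: valP.
Qed.

Lemma cf_njm x m : cf x m != 0 -> ~~ jm m.
Proof. by rewrite /cf; case: ifP; rewrite ?eqxx. Qed.

Lemma cf_scaleX k x m : cf ('X_[k] *: x) m = if jm m || ~~ (k <= m)%MM then 0 else cf x (m - k).
Proof.
rewrite -[x]repK -clsZ !cf_cls; case: ifP => [//|njm].
rewrite valZ mcoeffXM orFb; case: ifP => //= km; case: ifP => // /(jm_up (lem_subr m k)).
by rewrite njm.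
Qed.

Definition vars (s : seq 'I_n) : seq S := [seq 'X_i | i <- s].

(** A monomial of I is a multiple of x_j in the module I exactly when its x_j-exponent
    exceeds that of f.  As the submodule is spanned by monomials, membership can be
    tested on each coefficient separately. *)
Lemma in_seq_mul_vars (s : seq 'I_n) (x : M) : {in s, forall j, f j != 0%N} ->
  in_seq_mul (vars s) x <->
  forall m, cf x m != 0 -> exists2 j, j \in s & (f j < m j)%N.
Proof.
elim/last_ind: s x => [|s j IH] x fs.
  rewrite in_seq_mul_nil; split=> [-> m | H]; first by rewrite cf0 eqxx.
  by apply: cf_inj => m; case: (eqVneq (cf x m) 0) => // /H[].
have fj : f j != 0%N by apply: fs; rewrite mem_rcons inE eqxx.
have {}IH y : in_seq_mul (vars s) y <->
    forall m, cf y m != 0 -> exists2 i, i \in s & (f i < m i)%N.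
  by apply: IH => i si; apply: fs; rewrite mem_rcons inE si orbT.
rewrite /vars map_rcons in_seq_mul_rcons; split=> [[v /IH H] m xm | H].
  case: (ltnP (f j) (m j)) => [lt | ge]; first by exists j; rewrite // mem_rcons inE eqxx.
  have [|i si lt] := H m; last by exists i; rewrite // mem_rcons inE si orbT.
  rewrite cfD cfN cf_scaleX; case: ifP => [_|/negbT]; first by rewrite subr0.
  rewrite negb_or negbK => /andP[_ jm0]; case: (eqVneq (cf v (m - U_(j))) 0) => [->|].
    by rewrite subr0.
  move/cf_supp/mnm_lepP/(_ j); rewrite mnmBE mnm1E eqxx => le.
  rewrite lep1mP -lt0n in jm0; rewrite -(prednK jm0) subn1 /= in le ge *.
  by rewrite ltnNge le in ge.
(* Split x into x_j v and a remainder r without terms that x_j divides in I. *)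
pose p : S := val (rep x).
have pI m : p@_m != 0 -> (f <= m)%MM by move: m; apply/memI; apply: valP.
pose v : S := \sum_(m <- msupp p | (f j < m j)%N) p@_m *: 'X_[m - U_(j)].
pose r : S := \sum_(m <- msupp p | ~~ (f j < m j)%N) p@_m *: 'X_[m].
have rE m : r@_m = if (f j < m j)%N then 0 else p@_m by rewrite mcoeff_filter if_neg.
have pE : p = 'X_j * v + r.
  rewrite [LHS]mpolyE (bigID (fun m : 'X_{1..n} => (f j < m j)%N)) /=; congr (_ + _).
  rewrite mulr_sumr; apply: eq_bigr => m lt; rewrite -scalerAr -mpolyXD addmC submK //.
  by rewrite lep1mP -lt0n (leq_ltn_trans _ lt).
have rI : (r : S^o) \in I.
  by apply/memI => m; rewrite rE; case: ifP => [_|_ /pI //]; rewrite eqxx.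
have vI : (v : S^o) \in I.
  rewrite /v big_seq_cond; apply: rpred_sum => m /andP[mp lt].
  apply/memI => k; rewrite mcoeffZ mcoeffX.
  case: (eqVneq _ k) => [<- _|]; last by rewrite mulr0 eqxx.
  have /mnm_lepP fm : (f <= m)%MM by apply: pI; rewrite -mcoeff_msupp.
  apply/mnm_lepP => i; rewrite mnmBE mnm1E; case: (eqVneq j i) => [<-|_]; last by rewrite subn0.
  by rewrite subn1 -ltnS (ltn_predK lt).
exists (cls (SubmodOf vI)); apply/IH => m.
have -> : x - 'X_j *: cls (SubmodOf vI) = cls (SubmodOf rI).
  rewrite -[x]repK -clsZ; apply/eqP; rewrite subr_eq -clsD; apply/eqP; congr cls.
  by apply: val_inj; rewrite [LHS]pE [RHS]valD valZ addrC.
rewrite cf_cls /= rE; case: ifP; rewrite ?eqxx // => njm; case: ifP; rewrite ?eqxx // => nlt pm.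
have [|i] := H m; first by rewrite /cf njm.
by rewrite mem_rcons inE => /predU1P[->|]; [rewrite nlt | exists i].
Qed.

(** Multiplying by x_j neither moves a monomial of I into J, by square freeness, since
    x_j divides f already, nor changes the exponents of the other variables. *)
Lemma vars_regular (s : seq 'I_n) : uniq s -> {in s, forall j, f j != 0%N} ->
  forall i, (i < size s)%N -> forall x : M,
    in_seq_mul (take i (vars s)) ((vars s)`_i *: x) -> in_seq_mul (take i (vars s)) x.
Proof.
case: s => [|j0 s'] //; set s := j0 :: s'; move=> us fs i si x.
have ft : {in take i s, forall j, f j != 0%N} by move=> j /mem_take/fs.
rewrite /vars -map_take (nth_map j0) //; set j := nth j0 s i.
have js : j \notin take i s.
  apply/negP => /(nthP j0)[k]; rewrite size_take si => ki; rewrite nth_take // => /eqP.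
  by rewrite nth_uniq ?(ltn_trans ki) // => /eqP ki'; rewrite ki' ltnn in ki.
rewrite !in_seq_mul_vars // => H m xm.
have fm := cf_supp xm.
have fj : f j != 0%N by apply: fs; apply: mem_nth.
have mj : m j != 0%N.
  by rewrite -lt0n; apply: leq_trans (mnm_lepP fm j); rewrite lt0n.
have [|k kt lt] := H (m + U_(j))%MM; last first.
  exists k => //; move: lt; rewrite mnmDE mnm1E; case: eqVneq => [jk|]; last by rewrite addn0.
  by rewrite jk kt in js.
rewrite cf_scaleX lem_addl addmK /= orbF; case: ifP => // /(jm_sqf mj).
by rewrite (negbTE (cf_njm xm)).
Qed.

Definition theta : S := \sum_(i < n | f i == 0%N) 'X_i.
Definition fsupp : seq 'I_n := enum [pred i | f i != 0%N].

Lemma mem_fsupp : {in fsupp, forall j, f j != 0%N}.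
Proof. by move=> j; rewrite mem_enum. Qed.

(** Face rings of complexes with a vertex have theta as a nonzerodivisor.  Take a
    monomial m of I that lies neither in J nor in the submodule spanned by the
    variables of f, and choose a variable x_i outside f with m x_i not in J: one that
    divides m, or the vertex v when m = f.  The coefficient of m x_i in theta x is
    that of m in x plus those of monomials m x_i / x_l, whose x_i-exponent is larger
    and which satisfy the same conditions; induction downwards on the exponent of
    x_i shows that all of these vanish. *)
Lemma theta_regular v (x : M) : f v = 0%N -> ~~ jm (f + U_(v))%MM ->
  in_seq_mul (vars fsupp) (theta *: x) -> in_seq_mul (vars fsupp) x.
Proof.
move=> fv jv; rewrite !(in_seq_mul_vars _ mem_fsupp) => H.
pose L (m : 'X_{1..n}) := forall j, f j != 0%N -> (m j <= f j)%N.
pose B := msize (val (rep x) : S).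
have xB m : cf x m != 0 -> (mdeg m < B)%N.
  by rewrite /cf; case: ifP; rewrite ?eqxx // => _; rewrite -mcoeff_msupp; apply: msize_mdeg_lt.
have main i k (m : 'X_{1..n}) : (B - m i <= k)%N -> f i = 0%N -> L m ->
    ~~ jm (m + U_(i))%MM -> cf x m = 0.
  elim: k m => [|k IH] m Bk fi Lm jmi.
    apply/eqP; case: eqP => // /eqP/xB; rewrite ltnNge => /negP[].
    have Bm : (B <= m i)%N by rewrite -subn_eq0 -leqn0.
    by apply: leq_trans Bm _; rewrite mdegE (bigD1 i) //= leq_addr.
  have [/eqP//|xm] := boolP (cf x m == 0).
  suff : cf (theta *: x) (m + U_(i))%MM = cf x m.
    move=> E; have [|j] := H (m + U_(i))%MM; first by rewrite E.
    move=> /mem_fsupp fj; rewrite mnmDE mnm1E; case: eqVneq => [ij|_].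
      by rewrite -ij fi in fj.
    by rewrite addn0 ltnNge Lm.
  rewrite /theta scaler_suml cf_sum (bigD1 i) ?fi //= big1 ?addr0.
    by rewrite cf_scaleX (negbTE jmi) lem_addl addmK.
  move=> l /andP[/eqP fl li]; rewrite cf_scaleX (negbTE jmi) lep1mP /= negbK mnmDE mnm1E.
  rewrite eq_sym in li; rewrite (negbTE li) addn0; case: eqVneq => // ml.
  have E j : (m + U_(i) - U_(l))%MM j = (m j + (i == j) - (l == j))%N.
    by rewrite mnmBE mnmDE !mnm1E.
  apply: IH => //.
  - rewrite E eqxx eq_sym (negbTE li) subn0 addn1 subnS.
    by case: (B - m i)%N Bk.
  - move=> j fj; rewrite E; apply: leq_trans (leq_subr _ _) _.
    by case: eqVneq => [ij|]; rewrite ?addn0 ?Lm //; rewrite -ij fi in fj.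
  - apply: contra jmi => jj; apply: (@jm_sqf _ i); first by rewrite mnmDE mnm1E eqxx addn1.
    apply: jm_up jj; apply/mnm_lepP => j; rewrite !mnmDE E !mnm1E leq_add2r; exact: leq_subr.
move=> m xm; have fm := mnm_lepP (cf_supp xm).
have [/existsP[j /andP[fj lt]]|nL] := boolP [exists j, (f j != 0%N) && (f j < m j)%N].
  by exists j => //; rewrite mem_enum.
have Lm : L m.
  by move=> j fj; rewrite leqNgt; apply: contra nL => lt; apply/existsP; exists j; rewrite fj.
suff [i fi ji] : exists2 i, f i = 0%N & ~~ jm (m + U_(i))%MM.
  by rewrite (main i _ m (leqnn _) fi Lm ji) eqxx in xm.
have [i /andP[/eqP fi mi]|none] := pickP (fun i => (f i == 0%N) && (m i != 0%N)).
  by exists i => //; apply: contra (cf_njm xm); apply: jm_sqf.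
exists v => //; suff -> : m = f by [].
apply/mnmP => j; have := none j; case: eqVneq => [-> /= /negbFE/eqP // | fj _].
by apply/eqP; rewrite eqn_leq Lm // fm.
Qed.

Lemma mem_max_ideal (i : 'I_n) : @graded_max_ideal K n 'X_i.
Proof.
exists 1%N, (fun=> 1), (fun=> 'X_i); split; first by move=> _; exists i.
by rewrite big_ord1 scale1r.
Qed.

Lemma in_spanD (A : S^o -> Prop) x y : in_span A x -> in_span A y -> in_span A (x + y).
Proof.
move=> [k [c [u [Au ->]]]] [l [d [v [Av ->]]]].
exists (k + l)%N, (fun i => match split i with inl j => c j | inr j => d j end).
exists (fun i => match split i with inl j => u j | inr j => v j end); split.
  by move=> i; case: split.
rewrite big_split_ord /=; congr (_ + _); apply: eq_bigr => i _.
  case: splitP => j /= E; first by have -> : i = j by apply: val_inj.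
  by have := ltn_ord i; rewrite E ltnNge leq_addr.
case: splitP => j /= E; first by have := ltn_ord j; rewrite -E ltnNge leq_addr.
by have -> : i = j by apply: val_inj; apply: (addnI E).
Qed.

(** The maximal regular sequence consists of the variables of f and theta; the socle
    element is the sum of x_i f over the union W of connected components. *)
Theorem depth_of_separation (W : {set 'I_n}) (w v : 'I_n) :
    w \in W -> v \notin W -> f v = 0%N -> ~~ jm (f + U_(v))%MM ->
    {in W, forall i, f i = 0%N} -> {in W, forall i, ~~ jm (f + U_(i))%MM} ->
    (forall i j, i \in W -> j \notin W -> f j = 0%N -> jm (f + U_(i) + U_(j))%MM) ->
  is_depth M (@graded_max_ideal K n) (size fsupp).+1.
Proof.
move=> wW vW fv jv fW jW sep.
have fI : ('X_[f] : S^o) \in I.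
  by apply/memI => m; rewrite mcoeffX; case: (eqVneq f m) => [<- _|_]; rewrite ?lepm_refl ?eqxx.
pose e := cls (SubmodOf fI).
have cfe m : cf e m = (f == m)%:R.
  rewrite cf_cls /= mcoeffX; case: ifP => // jmm; case: eqVneq => // E.
  by rewrite -E (negbTE jm_f) in jmm.
have mon0 k : jm (f + k)%MM -> 'X_[k] *: e = 0.
  move=> jk; apply: cf_inj => m; rewrite cf_scaleX; case: ifP => // /norP[jmm /negPn km].
  rewrite cfe; case: eqVneq => // E; rewrite E submK // in jk.
  by rewrite jk in jmm.
pose z := \sum_(i in W) 'X_i *: e.
have szE : size (rcons (vars fsupp) theta) = (size fsupp).+1 by rewrite size_rcons size_map.
rewrite -szE; apply: (@is_depth_socle _ _ _ [seq 'X_i | i <- enum 'I_n] _ z).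
- move=> r [k [c [u [Hu ->]]]]; exists k, c, u; split=> // i.
  by have [j ->] := Hu i; apply: map_f; rewrite mem_enum.
- move=> r; rewrite mem_rcons inE => /predU1P[->|/mapP[i _ ->]]; last exact: mem_max_ideal.
  apply: (big_ind (@graded_max_ideal K n)) => [||i _]; last exact: mem_max_ideal.
    by exists 0%N, (fun=> 0), (fun=> 0); split; [case | rewrite big_ord0].
  exact: in_spanD.
- move=> i; rewrite szE ltnS leq_eqVlt => /predU1P[->|lt] x.
    rewrite -cats1 take_size_cat ?size_map // nth_cat size_map ltnn subnn /=.
    exact: theta_regular jv.
  rewrite -cats1 take_cat nth_cat size_map lt.
  by apply: vars_regular; rewrite ?enum_uniq //; apply: mem_fsupp.
- move=> _ /mapP[j _ ->]; have [fj|fj] := eqVneq (f j) 0%N; last first.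
    apply: in_seq_mul_mem; rewrite mem_rcons inE; apply/orP; right.
    by apply: map_f; rewrite mem_enum.
  have [jW'|jW'] := boolP (j \in W); last first.
    suff -> : 'X_j *: z = 0 by case: (in_seq_mul_submod M (rcons (vars fsupp) theta)).
    rewrite scaler_sumr big1 // => i iW; rewrite scalerA -mpolyXD mon0 //.
    by rewrite [(U_(j) + _)%MM]addmC addmA; apply: sep.
  suff -> : 'X_j *: z = theta *: ('X_j *: e).
    by apply: in_seq_mul_mem; rewrite mem_rcons inE eqxx.
  rewrite /theta scaler_suml scaler_sumr big_mkcond [RHS]big_mkcond; apply: eq_bigr => i _.
  case: ifP => [iW | niW]; first by rewrite fW // eqxx !scalerA mulrC.
  case: eqVneq => // fi; rewrite scalerA -mpolyXD mon0 //.
  by rewrite [(U_(i) + _)%MM]addmC addmA; apply: sep; rewrite ?niW.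
rewrite in_seq_mul_rcons => -[y /(in_seq_mul_vars _ mem_fsupp) H].
(* The coefficient of x_i f in theta y is that of f in y, since no other x_l outside f
   divides x_i f; so it does not depend on i. *)
have low i : f i = 0%N -> ~~ jm (f + U_(i))%MM -> cf z (f + U_(i))%MM = cf y f.
  move=> fi ji; have : cf (z - theta *: y) (f + U_(i))%MM = 0.
    have [//|/H] := eqVneq (cf (z - theta *: y) (f + U_(i))%MM) 0.
    move=> [j /mem_fsupp fj]; rewrite mnmDE mnm1E.
    by case: eqVneq => [ij|]; [rewrite -ij fi in fj | rewrite addn0 ltnn].
  rewrite cfD cfN => /eqP; rewrite subr_eq0 => /eqP ->.
  rewrite /theta scaler_suml cf_sum (bigD1 i) ?fi //= big1 ?addr0.
    by rewrite cf_scaleX (negbTE ji) lem_addl addmK.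
  move=> l /andP[/eqP fl]; rewrite eq_sym => /negbTE li.
  rewrite cf_scaleX lep1mP mnmDE mnm1E fl add0n li.
  by rewrite orbT.
have cfz i : ~~ jm (f + U_(i))%MM -> cf z (f + U_(i))%MM = (i \in W)%:R.
  move=> ji; rewrite cf_sum.
  have E l : cf ('X_l *: e) (f + U_(i))%MM = (i == l)%:R.
    rewrite cf_scaleX (negbTE ji) /=; case: ifP => [|/negbFE lf].
      by case: eqVneq => [->|//]; rewrite lem_addl.
    by rewrite cfe -(eqm_add2r U_(l)) submK // eqm_add2l eq_mnm1 eq_sym.
  rewrite (eq_bigr _ (fun l _ => E l)); have [iW|iW] := boolP (i \in W).
    rewrite (bigD1 i) //= eqxx big1 ?addr0 // => l /andP[_ li].
    by rewrite eq_sym (negbTE li).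
  by rewrite big1 // => l lW; case: eqVneq => // il; rewrite il lW in iW.
have := oner_neq0 K; rewrite -[1]/(true%:R) -wW -cfz ?jW // low ?fW ?jW //.
by rewrite -(low v) // cfz // (negbTE vW) eqxx.
Qed.

End Subquotient.

(** * Graphs with few edges are disconnected *)

(** Grow W from one vertex v0, keeping at most one vertex more than the edges inside W.
    An edge leaving W would allow one more vertex, so a largest such W has none; it is
    not all of V, which has too many vertices. *)
Lemma few_edges_disconnected (T : finType) (V : {set T}) (E : {set {set T}}) :
    (#|E| + 1 < #|V|)%N ->
  exists2 W : {set T}, (W \subset V) && (W != set0) && (W != V) &
    {in W & V :\: W, forall a b, [set a; b] \notin E}.
Proof.
move=> EV; have /card_gt0P[v0 v0V] : (0 < #|V|)%N by apply: leq_trans EV; rewrite addn1.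
pose inside (W : {set T}) := [set e in E | e \subset W].
pose P (W : {set T}) := [&& W \subset V, v0 \in W & (#|W| <= #|inside W| + 1)%N].
have P0 : P [set v0] by rewrite /P sub1set v0V set11 cards1 addn1.
have [W /and3P[WV v0W cW] maxW] := @arg_maxnP _ _ P (fun W => #|W|) P0.
exists W.
  rewrite WV /=; apply/andP; split; first by apply/set0Pn; exists v0.
  apply: contraTneq EV => WE; rewrite -leqNgt -WE; apply: leq_trans cW _.
  by rewrite leq_add2r subset_leq_card //; apply/subsetP => e; rewrite inE => /andP[].
move=> a b aW; rewrite inE => /andP[bW bV]; apply/negP => abE.
have /maxW : P (b |: W); last by rewrite cardsU1 bW add1n /= ltnn.
rewrite /P subUset sub1set bV WV inE v0W orbT cardsU1 bW /= add1n -addn1 leq_add2r.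
apply: leq_trans cW _; rewrite addn1; apply: proper_card; apply/properP; split.
  apply/subsetP => e; rewrite !inE => /andP[-> eW]; exact: subset_trans eW (subsetUr _ _).
by exists [set a; b]; rewrite !inE abE ?subUset ?sub1set ?inE ?aW ?eqxx ?orbT //=.
Qed.

(** * Square free monomials as faces *)

Section Faces.
Local Open Scope ring_scope.
Variables (K : fieldType) (n : nat).
Local Notation S := {mpoly K[n]}.

Definition set_mnm (A : {set 'I_n}) : 'X_{1..n} := [multinom (i \in A : nat) | i < n].

(** The faces with k vertices of the complex whose Stanley-Reisner ideal is J : f. *)
Definition faces (J : submodClosed S^o) (f : 'X_{1..n}) (k : nat) : {set {set 'I_n}} :=
  [set A : {set 'I_n} | [&& #|A| == k, [forall i in A, f i == 0%N] &
    ('X_[f + set_mnm A] : S^o) \notin J]].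

Lemma set_mnm1 i : set_mnm [set i] = U_(i)%MM.
Proof. by apply/mnmP => j; rewrite mnmE mnm1E inE eq_sym. Qed.

Lemma set_mnm2 i j : i != j -> set_mnm [set i; j] = (U_(i) + U_(j))%MM.
Proof.
move=> ij; apply/mnmP => k; rewrite mnmE mnmDE !mnm1E !inE ![k == _]eq_sym.
by case: eqVneq => // ik; rewrite -ik eq_sym (negbTE ij).
Qed.

Lemma mdeg_set_mnm A : mdeg (set_mnm A) = #|A|.
Proof.
rewrite mdegE -sum1_card [RHS]big_mkcond; apply: eq_bigr => i _.
by rewrite mnmE; case: (i \in A).
Qed.

(** The square free multiples of the square free monomial f are the products of f with
    distinct variables outside f. *)
Lemma rho_faces (I J : submodClosed S^o) (f : 'X_{1..n}) (k : nat) : squarefree f ->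
    (forall m, ('X_[m] : S^o) \in I <-> (f <= m)%MM) ->
  rho (mdeg f + k) I J = #|faces J f k|.
Proof.
move=> /forallP sf memI; rewrite /rho; set j := (mdeg f + k)%N.
pose phi (A : {set 'I_n}) : 'X_{1..n < j.+1} := insubd (bm0 : 'X_{1..n < j.+1}) (f + set_mnm A)%MM.
have phiE A : A \in faces J f k -> phi A = (f + set_mnm A)%MM :> 'X_{1..n}.
  rewrite inE => /and3P[/eqP cA _ _].
  by rewrite val_insubd mdegD mdeg_set_mnm cA leqnn.
rewrite -[RHS](card_in_imset (f := phi)); last first.
  move=> A B AF BF /(congr1 val); rewrite /= !phiE // => /addmI/mnmP AB.
  apply/setP => i; have := AB i; rewrite !mnmE.
  by case: (i \in A); case: (i \in B).
congr #|pred_of_set _|; apply/setP => m; rewrite inE; apply/idP/imsetP.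
  move=> /and4P[/eqP dm /forallP sm mI mJ].
  have /mnm_lepP fm := proj1 (memI m) mI.
  pose A := [set i | (f i == 0%N) && (m i != 0%N)].
  have mE : (f + set_mnm A)%MM = m.
    apply/mnmP => i; rewrite mnmDE mnmE inE.
    by move: (fm i) (sm i) (sf i); case: (f i) => [|[]//]; case: ((m : 'X_{1..n}) i) => [|[]].
  have AF : A \in faces J f k.
    rewrite inE mE mJ andbT; apply/andP; split; last first.
      by apply/forall_inP => i; rewrite inE => /andP[].
    by rewrite -(eqn_add2l (mdeg f)) -mdeg_set_mnm -mdegD mE dm.
  by exists A => //; apply: val_inj; rewrite /= phiE.
move=> [A AF ->]; rewrite phiE //; move: AF; rewrite inE => /and3P[/eqP cA /forall_inP A0 ->].
rewrite mdegD mdeg_set_mnm cA eqxx andbT /=; apply/andP; split; last exact/memI/lem_addr.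
apply/forallP => i; rewrite mnmDE mnmE; have := sf i.
by have [/A0/eqP-> | _] := boolP (i \in A); rewrite ?addn0.
Qed.

End Faces.

(** * The theorem *)

Theorem proposition1p1 (K : fieldType) (n d : nat) (d_ge1 : (1 <= d)%N)
  (f : 'X_{1..n}) (f_sqfree : squarefree f) (f_deg : mdeg f = d)
  (I J : submodClosed {mpoly K[n]}^o)
  (I_gen : generated_by (fun q : {mpoly K[n]}^o => q = 'X_[f]) I)
  (J_gen : sqfree_monomial_ideal_gen_ge d.+1 J)
  (J_sub_I : {subset J <= I})
  (J_neq_I : exists2 p : {mpoly K[n]}^o, p \in I & p \notin J)
  (rho_gt : (rho d.+1 I J > rho d.+2 I J + 1)%N) :
  is_depth (subquot I J) (@graded_max_ideal K n) d.+1.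
Proof.
have [G [sqG genG]] := J_gen.
have memI : forall p : {mpoly K[n]}^o, p \in I <->
    forall m, mcoeff m (p : {mpoly K[n]}) != 0%R -> (f <= m)%MM.
  have AG (q : {mpoly K[n]}^o) : q = 'X_[f]%R <-> exists2 g, f = g & q = 'X_[g]%R.
    by split=> [->|[g <- ->]] //; exists f.
  move=> p; rewrite (monomial_idealP AG I_gen); split=> H m /H; last by exists f.
  by case=> g <-.
have memJG := monomial_idealP (fun q => iff_refl _) genG.
have XJ m : ('X_[m]%R : {mpoly K[n]}^o) \in J <-> exists2 g, G g & (g <= m)%MM.
  rewrite memJG; split=> [| H k]; first by apply; rewrite mcoeffX eqxx oner_neq0.
  by rewrite mcoeffX; case: (eqVneq m k) => [<-|] //; rewrite eqxx.
have XI m : ('X_[m]%R : {mpoly K[n]}^o) \in I <-> (f <= m)%MM.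
  rewrite memI; split=> [| H k]; first by apply; rewrite mcoeffX eqxx oner_neq0.
  by rewrite mcoeffX; case: (eqVneq m k) => [<-|] //; rewrite eqxx.
have memJ : forall p : {mpoly K[n]}^o, p \in J <->
    forall m, mcoeff m (p : {mpoly K[n]}) != 0%R -> ('X_[m]%R : {mpoly K[n]}^o) \in J.
  by move=> p; rewrite memJG; split=> H m /H /XJ.
have jm_up (m m' : 'X_{1..n}) : (m <= m')%MM ->
    ('X_[m]%R : {mpoly K[n]}^o) \in J -> ('X_[m']%R : {mpoly K[n]}^o) \in J.
  move=> mm' /XJ[g Gg gm]; apply/XJ; exists g => //; exact: lepm_trans gm mm'.
have jm_sqf (m : 'X_{1..n}) i : m i != 0%N ->
    ('X_[m + U_(i)]%R : {mpoly K[n]}^o) \in J -> ('X_[m]%R : {mpoly K[n]}^o) \in J.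
  move=> mi /XJ[g Gg /mnm_lepP gm]; apply/XJ; exists g => //; apply/mnm_lepP => j.
  have := gm j; rewrite mnmDE mnm1E; case: eqVneq => [<- _|]; last by rewrite addn0.
  have [/forallP sg _] := sqG _ Gg; apply: leq_trans (sg i) _.
  by rewrite lt0n.
have jm_f : ('X_[f]%R : {mpoly K[n]}^o) \notin J.
  have [p pI pJ] := J_neq_I; apply: contra pJ => fJ; apply/memJ => m /(proj1 (memI p) pI) fm.
  exact: jm_up fm fJ.
pose V := [set i | (f i == 0%N) && (('X_[f + U_(i)]%R : {mpoly K[n]}^o) \notin J)].
have cV : (rho d.+1 I J <= #|V|)%N.
  rewrite -addn1 -f_deg rho_faces //; apply: leq_trans (leq_imset_card set1 V).
  apply: subset_leq_card; apply/subsetP => A; rewrite inE => /and3P[/cards1P[i ->] /forall_inP A0].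
  by rewrite set_mnm1 => fi; apply: imset_f; rewrite inE fi A0 ?set11.
have [|W /andP[/andP[/subsetP WV /set0Pn[w wW]] WnV] sep] :=
  @few_edges_disconnected _ V (faces J f 2).
  by rewrite -(rho_faces J 2 f_sqfree XI) f_deg addn2; apply: leq_trans rho_gt cV.
have /properP[_ [v vV vW]] : W \proper V.
  by rewrite properEneq WnV; apply/subsetP.
have Vf i : i \in V -> f i = 0%N by rewrite inE => /andP[/eqP].
have VJ i : i \in V -> ('X_[f + U_(i)]%R : {mpoly K[n]}^o) \notin J by rewrite inE => /andP[].
have dE : d = size (fsupp f).
  rewrite -f_deg mdegE -cardE -sum1_card [RHS]big_mkcond; apply: eq_bigr => i _ /=.
  by have /forallP/(_ i) := f_sqfree; rewrite inE; case: (f i) => [|[]].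
rewrite dE; apply: (depth_of_separation memI memJ jm_up jm_sqf jm_f wW vW).
- exact: Vf.
- exact: VJ.
- by move=> i /WV/Vf.
- by move=> i /WV/VJ.
- move=> i j iW jW fj; have [jV|] := boolP (j \in V); last first.
    rewrite inE fj negbK => jJ; apply: jm_up jJ; apply/mnm_lepP => k.
    by rewrite !mnmDE leq_add2r leq_addr.
  have ij : i != j by apply: contraNneq jW => <-.
  have jVW : j \in V :\: W by rewrite inE jW.
  have := sep i j iW jVW; rewrite inE cards2 ij /= set_mnm2 // addmA.
  case/nandP => [/forall_inPn[k] | /negPn //].
  by rewrite !inE => /orP[]/eqP->; rewrite ?fj // Vf ?WV.
Qed.
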